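(* Let $\pi\in\Pi(\mu,\nu)$, let $\{X_i\}_{i\in I}$ be a basic partition of $X$, let $\mathcal N\subset I\times I$ be a neighborhood set, and let $\hat\pi$ be a flow update of $\pi$ with gluing edge candidates (for arbitrary transport plans $\gamma_{ij}\in\Pi(\mu_i/m_i,\mu_j/m_j)$, $i\in I$, $j\in\mathcal N(i)\setminus\{i\}$). Then $\hat\pi$ has the same marginals as $\pi$, i.e. $\hat\pi\in\Pi(\mu,\nu)$, and the entropic optimal transport objective does not increase: $$\langle c,\hat\pi\rangle+\varepsilon\,\mathrm{KL}(\hat\pi|\mu\otimes\nu)\le\langle c,\pi\rangle+\varepsilon\,\mathrm{KL}(\pi|\mu\otimes\nu).$$
   Context: $X,Y$ are compact metric spaces; $\mu,\nu$ are probability measures on $X$ and $Y$ respectively; $\varepsilon\ge0$ (with $0\cdot\infty:=0$). $\mathrm P_X,\mathrm P_Y$ denote the maps taking a measure on $X\times Y$ to its $X$- and $Y$-marginal. $\Pi(\rho,\sigma)$ is the set of non-negative measures with first marginal $\rho$ and second marginal $\sigma$. $c:X\times Y\to\mathbb R$ is a positive, bounded, lower semicontinuous cost function, and $\langle\phi,\rho\rangle$ denotes the integral of $\phi$ against $\rho$. $\rho\llcorner S$ is the restriction of $\rho$ to $S$. Kullback–Leibler divergence: $\mathrm{KL}(\rho|\sigma):=\int\varphi\left(\frac{\mathrm d\rho}{\mathrm d\sigma}\right)\mathrm d\sigma$ if $\rho\ll\sigma$ and $\rho\ge0$, and $+\infty$ otherwise, with $\varphi(s)=s\log s-s+1$ for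 $s>0$ and $\varphi(0)=1$. Basic partition: for a finite index set $I$, $\{X_i\}_{i\in I}$ is a partition of $X$ into closed subsets that are disjoint up to a set of $\mu$-measure zero, with $m_i:=\mu(X_i)>0$ for all $i$. Set $\mu_i:=\mu\llcorner X_i$, $\pi_i:=\pi\llcorner(X_i\times Y)$ and $\nu_i:=\mathrm P_Y\pi_i$. Neighborhood set: a set $\mathcal N\subset I\times I$ with $(i,i)\in\mathcal N$ for all $i$, and $(i,j)\in\mathcal N$ iff $(j,i)\in\mathcal N$. Write $\mathcal N(i):=\{j\in I:(i,j)\in\mathcal N\}$. Mass preserving flows: $\mathcal F$ is the set of tuples $w=(w_{ij})_{(i,j)\in\mathcal N}$ with $w_{ij}\ge0$ and $\sum_{j\in\mathcal N(i)}w_{ij}=\sum_{j\in\mathcal N(i)}w_{ji}=m_i$ for all $i\in I$. Edge candidate: a candidate for edge $(i,j)\in\mathcal N$ is a coupling $\hat\pi_{ij}\in\Pi(\mu_j/m_j,\nu_i/m_i)$. Gluing edge candidate: for $i\in I$, $j\in\mathcal N(i)\setminus\{i\}$ and $\gamma_{ij}\in\Pi(\mu_i/m_i,\mu_j/m_j)$, it is the edge candidate $\hat\pi_{ij}$ on $X_j\times Y$ determined by $$\hat\pi_{ij}(A\times B):=\frac1{m_i}\int_{X_i}(\gamma_{ij})_x(A)\cdot(\pi_i)_x(B)\,\mathrm d\mu_i(x)$$ for measurable $A\times B\subset X_j\times Y$, where $(\gamma_{ij})_x$ and $(\pi_i)_x$ are the disintegrations (probability measures on $X_j$ and $Y$)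 of $\gamma_{ij}$ and $\pi_i$ at $x\in X_i$ against their $\mu_i/m_i$- and $\mu_i$-marginal, respectively. Flow update: given edge candidates $(\hat\pi_{ij})_{(i,j)\in\mathcal N}$ with $\hat\pi_{ii}=\pi_i/m_i$, define $\bar c_{ij}:=\langle c,\hat\pi_{ij}-\hat\pi_{ii}\rangle$ for $(i,j)\in\mathcal N$. A flow update of $\pi$ is a measure $\hat\pi:=\sum_{j\in I}\hat\pi_j$ with $\hat\pi_j:=\sum_{i\in\mathcal N(j)}w_{ij}\,\hat\pi_{ij}$, where $w$ is any solution of the min-cost flow problem $\min_{w\in\mathcal F}\sum_{(i,j)\in\mathcal N}w_{ij}\bar c_{ij}$ (not necessarily unique). A flow update ''with gluing edge candidates'' is one where $\hat\pi_{ij}$ is a gluing edge candidate for all $(i,j)\in\mathcal N$ with $i\ne j$. *)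

(* Defs.v *)
From HB Require Import structures.
From mathcomp Require Import all_boot all_order all_algebra.
From mathcomp Require Import all_classical all_reals all_analysis.

Set Implicit Arguments.
Unset Strict Implicit.
Unset Printing Implicit Defensive.

Import Order.TTheory GRing.Theory Num.Theory.
Import numFieldNormedType.Exports.

Local Open Scope classical_set_scope.
Local Open Scope ring_scope.
Local Open Scope charge_scope.

(* Metric spaces carrying their Borel sigma-algebra. A measurable type is
   pointed, so the empty space is excluded; it has no probability measure.
   On X * Y, the library's sigma-algebra is the product one, which is the Borel
   sigma-algebra of the product when X and Y are compact. *)
HB.mixin Record isBorel d T & Topological T & Measurable d T := {
  measurable_borelE : (@measurable d T) = <<s (@open T) >>
}.

#[short(type="borelMetricType")]
HB.structure Definition BorelMetric (K : numDomainType) (d : measure_display) :=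
  { T of Metric K T & Measurable d T & isBorel d T }.

Lemma closed_measurable (K : numDomainType) d (T : borelMetricType K d)
  (A : set T) : closed A -> measurable A.
Proof.
move=> cA; rewrite -[A]setCK; apply: measurableC.
by rewrite measurable_borelE; apply: sub_sigma_algebra; exact: closed_openC.
Qed.

Section divergence.
Context d (T : measurableType d) (R : realType).

Definition KL_integrand (s : R) : R := if 0 < s then s * ln s - s + 1 else 1.

(* rho is a signed measure, hence the explicit nonnegativity test. The Radon-Nikodym derivative
   is finite everywhere; it may be negative on a sigma-null set, where the value
   of [KL_integrand] does not matter. *)
Definition KL (rho : {charge set T -> \bar R})
    (sigma : {sigma_finite_measure set T -> \bar R}) : \bar R :=
  if `[< rho `<< sigma /\ forall A, measurable A -> (0 <= rho A)%E >]
  then (\int[sigma]_x (KL_integrand (fine ('d rho '/d sigma x)))%:E)%E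
  else +oo%E.

Definition scaled (a : R) (rho : set T -> \bar R) : set T -> \bar R :=
  fun A => (a%:E * rho A)%E.

End divergence.

Section couplings.
Context d1 d2 (T1 : measurableType d1) (T2 : measurableType d2) (R : realType).
Implicit Types pi : set (T1 * T2) -> \bar R.

Definition marginal1 pi : set T1 -> \bar R :=
  pushforward pi fst.

Definition marginal2 pi : set T2 -> \bar R :=
  pushforward pi snd.

(* [coupling rho sigma pi] reads: pi belongs to Pi(rho, sigma). Measures are
   compared on measurable sets only, since a measure is formally a set function
   defined on all sets. *)
Definition coupling (rho : set T1 -> \bar R) (sigma : set T2 -> \bar R) pi :
    Prop :=
  (forall A, measurable A -> marginal1 pi A = rho A) /\
  (forall B, measurable B -> marginal2 pi B = sigma B).

Definition disintegration pi (k : R.-pker T1 ~> T2) : Prop :=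
  forall A B, measurable A -> measurable B ->
    pi (A `*` B) = (\int[marginal1 pi]_(x in A) k x B)%E.

End couplings.

Section transport.
Context (R : realType) (dX dY : measure_display).
Context (X : borelMetricType R dX) (Y : borelMetricType R dY).
Context (mu : {measure set X -> \bar R}) (I : finType).

Structure basic_partition := BasicPartition {
  cell :> I -> set X ;
  cell_closed : forall i, closed (cell i) ;
  cell_cover : \bigcup_i cell i = [set: X] ;
  cell_disjoint : forall i j, i != j -> mu (cell i `&` cell j) = 0%E ;
  cell_mass_gt0 : forall i, (0 < mu (cell i))%E
}.

Definition neighborhood_set (N : {set I * I}) : Prop :=
  (forall i, (i, i) \in N) /\ (forall i j, ((i, j) \in N) = ((j, i) \in N)).

Variables (P : basic_partition) (N : {set I * I}).

Lemma cell_measurable i : measurable (P i).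
Proof. by apply: closed_measurable; exact: cell_closed. Qed.

Lemma strip_measurable i : measurable (P i `*` [set: Y]).
Proof. by apply: measurableX; [exact: cell_measurable|exact: measurableT]. Qed.

Definition mass (i : I) : R := fine (mu (P i)).

Definition mu_ (i : I) : set X -> \bar R := mrestr mu (cell_measurable i).

(* Only the values w i j with (i, j) in N are relevant. *)
Definition mass_preserving_flow (w : I -> I -> R) : Prop :=
  (forall i j, (i, j) \in N -> 0 <= w i j) /\
  (forall i, \sum_(j | (i, j) \in N) w i j = mass i /\
             \sum_(j | (i, j) \in N) w j i = mass i).

Definition flow_cost (cbar : I -> I -> R) (w : I -> I -> R) : R :=
  \sum_(p in N) w p.1 p.2 * cbar p.1 p.2.

Definition min_cost_flow (cbar : I -> I -> R) (w : I -> I -> R) : Prop :=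
  mass_preserving_flow w /\
  forall w', mass_preserving_flow w' -> flow_cost cbar w <= flow_cost cbar w'.

Variable pi : {measure set (X * Y) -> \bar R}.

Definition pi_ (i : I) : set (X * Y) -> \bar R := mrestr pi (strip_measurable i).

Definition nu_ (i : I) : set Y -> \bar R := marginal2 (pi_ i).

Implicit Types cand : I -> I -> {measure set (X * Y) -> \bar R}.

Definition edge_candidate (i j : I) (pij : {measure set (X * Y) -> \bar R}) :
    Prop :=
  coupling (scaled (mass j)^-1 (mu_ j)) (scaled (mass i)^-1 (nu_ i)) pij.

(* Disintegrations are unique up to a null set, so the choice of kernels does
   not matter. *)
Definition gluing_edge_candidate (i j : I)
    (gamma : {measure set (X * X) -> \bar R})
    (pij : {measure set (X * Y) -> \bar R}) : Prop :=
  edge_candidate i j pij /\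
  exists (kgamma : R.-pker X ~> X) (kpi : R.-pker X ~> Y),
    [/\ disintegration gamma kgamma,
        disintegration (pi_ i) kpi &
        forall A B, measurable A -> measurable B -> A `<=` P j ->
          pij (A `*` B) = ((mass i)^-1%:E *
            \int[mu_ i]_(x in P i) (kgamma x A * kpi x B))%E].

(* Both integrals are finite when c is bounded, so this is the integral of c
   against the signed measure [cand i j - cand i i]. *)
Definition edge_cost (c : X * Y -> R) cand (i j : I) : R :=
  Rintegral (cand i j) setT c - Rintegral (cand i i) setT c.

Definition flow_update (c : X * Y -> R) cand
    (pihat : {measure set (X * Y) -> \bar R}) : Prop :=
  [/\ forall i j, (i, j) \in N -> edge_candidate i j (cand i j),
      forall i C, measurable C ->
        cand i i C = scaled (mass i)^-1 (pi_ i) C &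
      exists2 w, min_cost_flow (edge_cost c cand) w &
        forall C, measurable C -> pihat C =
          (\sum_(j in I) \sum_(i | (j, i) \in N) (w i j)%:E * cand i j C)%E].

End transport.

Section objective.
Context (R : realType) (dX dY : measure_display).
Context (X : measurableType dX) (Y : measurableType dY).

(* The library's [\x], packed as a probability so that it can serve as a
   reference measure. *)
Definition product_probability (mu : probability X R) (nu : probability Y R) :
  set (X * Y) -> \bar R := (mu \x nu)%E.

HB.instance Definition _ mu nu := Measure.on (product_probability mu nu).

Lemma product_probability_setT mu nu :
  product_probability mu nu [set: X * Y] = 1%E.
Proof.
rewrite -setXTT; transitivity (mu setT * nu setT)%E.
  exact: product_measure1E.
by rewrite !probability_setT mule1.
Qed.

HB.instance Definition _ mu nu := Measure_isProbability.Build _ _ _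
  (product_probability mu nu) (product_probability_setT mu nu).

(* In the extended reals of the library, 0 * +oo = 0. *)
Definition EOT_objective (mu : probability X R) (nu : probability Y R)
    (eps : R) (c : X * Y -> R)
    (pi : {finite_measure set (X * Y)%type -> \bar R}) : \bar R :=
  (\int[pi]_z (c z)%:E +
   eps%:E * KL (charge_of_finite_measure pi) (product_probability mu nu))%E.

End objective.

(* Main.v *)
(** The entropy inequality is a data-processing inequality, proved by duality.
    With sigma = mu (x) nu and phi(s) = s log s - s + 1, KL(rho | sigma) is the
    supremum over bounded h of int h drho - int (e^h - 1) dsigma: Young's
    inequality s t <= phi(s) + e^t - 1 gives one direction, truncations of
    log(drho/dsigma) and Fatou's lemma the other. A gluing candidate is the law
    of (x', y), where (x, y) has law pi_i/m_i and x' has law (gamma_ij)_x; the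
    same randomization maps sigma_i/m_i to sigma_j/m_j, with sigma_i the
    restriction of sigma to X_i x Y. Integrating Young's inequality at
    s = (dpi/dsigma)(x, y), t = h(x', y) bounds the dual functional on each edge
    by the entropy carried by cell i, with no need to disintegrate gamma_ij
    against its second marginal; weighting the edges by the flow w sums these
    bounds to KL(pi | sigma). The linear cost decreases because the diagonal
    flow w_ii = m_i is a competitor of cost zero. *)
From HB Require Import structures.
Require Import Defs.
From mathcomp Require Import all_boot all_order all_algebra.
From mathcomp Require Import all_classical all_reals all_analysis.
From mathcomp Require Import measurable_realfun lra.

Set Implicit Arguments.
Unset Strict Implicit.
Unset Printing Implicit Defensive.

Import Order.TTheory GRing.Theory Num.Theory.
Import numFieldNormedType.Exports.

Local Open Scope classical_set_scope.
Local Open Scope ring_scope.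

(** * Duality for the Kullback-Leibler divergence *)

Section kl_integrand.
Context (R : realType).
Implicit Types s t : R.

Lemma KL_integrand_young s t : 0 <= s ->
  s * t <= KL_integrand s + expR t - 1.
Proof.
rewrite le_eqVlt /KL_integrand => /predU1P[<-|s0].
  by rewrite ltxx mul0r addrAC subrr add0r expR_ge0.
rewrite s0.
have : s * (1 + (t - ln s)) <= expR t.
  rewrite (_ : expR t = s * expR (t - ln s)); last first.
    by rewrite expRB lnK ?posrE// mulrC divfK ?gt_eqF.
  by rewrite ler_pM2l// expR_ge1Dx.
by rewrite !mulrDr mulr1 mulrN; lra.
Qed.

Lemma KL_integrand_ge0 s : 0 <= KL_integrand s.
Proof.
have [s0|s0] := ltP s 0; first by rewrite /KL_integrand ltNge (ltW s0).
by have := KL_integrand_young 0 s0; rewrite expR0 mulr0; lra.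
Qed.

Lemma measurable_KL_integrand : measurable_fun setT (@KL_integrand R).
Proof.
apply: measurable_fun_ifT => //; first exact: measurable_fun_ltr.
apply: measurable_funD => //; apply: measurable_funB => //.
by apply: measurable_funM => //; exact: measurable_ln.
Qed.

(* Truncating the dual optimizer [ln s] of [KL_integrand_young] to a bounded
   function keeps the approximants of [KL_integrand s] nonnegative, as Fatou's
   lemma requires. *)
Definition clamp (n : nat) s : R :=
  Num.max n.+1%:R^-1 (Num.min s n.+1%:R).

Lemma clamp_ge n s : n.+1%:R^-1 <= clamp n s.
Proof. by rewrite /clamp le_max lexx. Qed.

Lemma clamp_le n s : clamp n s <= n.+1%:R.
Proof.
rewrite /clamp ge_max ge_min lexx orbT andbT.
by apply: (@le_trans _ _ 1); rewrite ?invf_le1 ?ler1n ?ltr0n.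
Qed.

Lemma clamp_gt0 n s : 0 < clamp n s.
Proof. by apply: lt_le_trans (clamp_ge n s); rewrite invr_gt0 ltr0n. Qed.

Lemma clamp_id n s : n.+1%:R^-1 <= s <= n.+1%:R -> clamp n s = s.
Proof.
by move=> /andP[ns sn]; rewrite /clamp (min_idPl sn) (max_idPr ns).
Qed.

Lemma clamp_gap_ge0 n s : 0 <= s -> 0 <= s * ln (clamp n s) - clamp n s + 1.
Proof.
move=> s0; have c0 := clamp_gt0 n s.
have := KL_integrand_ge0 (clamp n s); rewrite /KL_integrand c0.
suff : clamp n s * ln (clamp n s) <= s * ln (clamp n s) by lra.
have n1 : 1 <= n.+1%:R :> R by rewrite ler1n.
have nV1 : n.+1%:R^-1 <= 1 :> R by rewrite invf_le1 ?ltr0n.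
have [sn|ns] := leP s n.+1%:R; last first.
  rewrite ler_wpM2r//; last first.
    by rewrite (le_trans _ (ltW ns))// clamp_le.
  by apply: ln_ge0; rewrite /clamp (min_idPr (ltW ns)) le_max n1 orbT.
rewrite /clamp (min_idPl sn); have [sn'|ns'] := leP n.+1%:R^-1 s => //.
by rewrite ler_wnM2r ?ln_le0 ?(ltW ns').
Qed.

Lemma clamp_gap_cvg s : 0 <= s ->
  (s * ln (clamp n s) - clamp n s + 1) @[n --> \oo] --> KL_integrand s.
Proof.
rewrite le_eqVlt /KL_integrand => /predU1P[<-|s0].
  rewrite ltxx -[X in _ --> X]add0r; apply: cvgD; last exact: cvg_cst.
  rewrite (_ : (fun _ => _) = -%R \o (fun n => n.+1%:R^-1)); last first.
    by apply/funext => n /=; rewrite mul0r sub0r /clamp min_l// max_l.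
  by rewrite -oppr0; apply: cvgN; exact: cvg_harmonic.
rewrite s0; apply: cvg_near_cst; near=> n.
rewrite clamp_id//; apply/andP; split.
  rewrite -[leRHS]invrK lef_pV2 ?posrE ?invr_gt0 ?ltr0n//.
  by rewrite (@le_trans _ _ n%:R) ?ler_nat//; near: n; exact: nbhs_infty_ger.
by rewrite (@le_trans _ _ n%:R) ?ler_nat//; near: n; exact: nbhs_infty_ger.
Unshelve. all: by end_near. Qed.

Lemma measurable_clamp n : measurable_fun setT (clamp n).
Proof. by apply: measurable_maxr => //; exact: measurable_minr. Qed.

End kl_integrand.

Section kl_duality.
Local Open Scope ereal_scope.
Context d (T : measurableType d) (R : realType).

Lemma KL_density (rho : {finite_measure set T -> \bar R})
    (sigma : {sigma_finite_measure set T -> \bar R}) :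
  rho `<< sigma -> exists f : T -> R,
  [/\ measurable_fun setT f, (forall x, (0 <= f x)%R),
      forall H : T -> \bar R, (forall x, 0 <= H x) -> measurable_fun setT H ->
        \int[rho]_x H x = \int[sigma]_x (H x * (f x)%:E) &
      KL (charge_of_finite_measure rho) sigma =
        \int[sigma]_x (KL_integrand (f x))%:E].
Proof.
move=> rs; pose g := Radon_Nikodym_SigmaFinite.f rho sigma.
have gfin x : g x \is a fin_num by exact: Radon_Nikodym_SigmaFinite.f_fin_num.
have g0 x : 0 <= g x by exact: Radon_Nikodym_SigmaFinite.f_ge0.
have mg : measurable_fun setT g.
  exact: measurable_int (Radon_Nikodym_SigmaFinite.f_integrable rs).
have mfg : measurable_fun setT (fine \o g) by exact: measurableT_comp.
exists (fine \o g); split => //=.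
- by move=> x; exact: fine_ge0.
- move=> H H0 mH; rewrite -(Radon_Nikodym_SigmaFinite.change_of_variables rs)//.
  by apply: eq_integral => x _; rewrite fineK//; exact: gfin.
rewrite /KL; case: asboolP => [_|]; last first.
  by case; split => // A mA; exact: measure_ge0.
apply: ge0_ae_eq_integral => //.
- apply/measurable_EFinP; apply: measurableT_comp => //.
    exact: measurable_KL_integrand.
  exact: measurableT_comp.
- apply/measurable_EFinP; apply: measurableT_comp => //.
  exact: measurable_KL_integrand.
- by move=> x _; rewrite lee_fin KL_integrand_ge0.
- by move=> x _; rewrite lee_fin KL_integrand_ge0.
have := @ae_eq_Radon_Nikodym_SigmaFinite _ _ _ rho sigma rs _ measurableT.
by apply: filterS => x /= gx _; rewrite -gx.
Qed.

Variables (rho : {finite_measure set T -> \bar R}) (sigma : probability T R).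
Variable K : R.
Hypothesis rho1 : rho setT = 1.
(* The inequality [\int h drho - \int (expR h - 1) dsigma <= K], rearranged so
   that only nonnegative functions are integrated. *)
Hypothesis dualK : forall (C : R) (h : T -> R), (0 <= C)%R ->
  measurable_fun setT h -> (forall x, (- C <= h x)%R) ->
  \int[rho]_x (h x + C)%:E + 1 <= K%:E + \int[sigma]_x (expR (h x))%:E + C%:E.

Lemma dominates_dual : rho `<< sigma.
Proof.
apply/null_content_dominatesP => A mA sA0; apply/eqP.
have key n : n%:R%:E * rho A <= K%:E.
  pose h (x : T) : R := (n%:R * \1_A x)%R.
  have h0 x : (0 <= h x)%R by rewrite mulr_ge0.
  have mh : measurable_fun setT h by exact: measurable_funM.
  have := @dualK 0%R h (lexx _) mh; rewrite oppr0 adde0 => /(_ h0).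
  under eq_integral do rewrite addr0 EFinM.
  rewrite ge0_integralZl//; last exact/measurable_EFinP.
  rewrite integral_indic// setIT.
  rewrite [X in _ <= _ + X](_ : _ = 1); last first.
    transitivity (\int[sigma]_x (1 : R)%:E).
      apply: ge0_ae_eq_integral => //.
      - by apply/measurable_EFinP; exact: measurableT_comp.
      exists A; split => // x /=; apply: contra_notP => Ax _.
      by rewrite /h indicE memNset// mulr0 expR0.
    by rewrite integral_cst// mul1e; exact: probability_setT.
  by rewrite leeD2rE.
have rA : rho A \is a fin_num by exact: fin_num_measure.
rewrite eq_le measure_ge0 andbT leNgt; apply/negP => rA0.
have fA0 : (0 < fine (rho A))%R by rewrite fine_gt0// rA0 ltey_eq rA.
have := key (Num.trunc (`|K| / fine (rho A))).+1.
rewrite -(fineK rA) -EFinM lee_fin leNgt => /negP; apply.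
rewrite (le_lt_trans (ler_norm _))// -ltr_pdivrMr//.
have := truncn_itv (divr_ge0 (normr_ge0 K) (ltW fA0)).
by case/andP.
Qed.

Lemma KL_le_dual : KL (charge_of_finite_measure rho) sigma <= K%:E.
Proof.
have [f [mf f0 rhof ->]] := KL_density dominates_dual.
pose F n x : \bar R := (f x * ln (clamp n (f x)) - clamp n (f x) + 1)%:E.
have mc n : measurable_fun setT (fun x => clamp n (f x)).
  by apply: measurableT_comp => //; exact: measurable_clamp.
have mln n : measurable_fun setT (fun x => ln (clamp n (f x))).
  by apply: measurableT_comp => //; exact: measurable_ln.
have mF n : measurable_fun setT (F n).
  apply/measurable_EFinP; apply: measurable_funD => //.
  by apply: measurable_funB => //; exact: measurable_funM.
have F0 n x : 0 <= F n x by rewrite lee_fin clamp_gap_ge0.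
have FK n : \int[sigma]_x F n x <= K%:E.
  pose C : R := ln n.+1%:R.
  have C0 : (0 <= C)%R by rewrite ln_ge0// ler1n.
  have hC x : (- C <= ln (clamp n (f x)))%R.
    rewrite -lnV ?posrE ?ltr0n// ler_ln ?posrE ?invr_gt0 ?ltr0n ?clamp_gt0//.
    exact: clamp_ge.
  have := dualK C0 (mln n) hC.
  under [X in _ <= _ + X + _]eq_integral do rewrite lnK ?posrE ?clamp_gt0//.
  rewrite rhof; last 2 first.
  - by move=> x; rewrite lee_fin -lerBlDr sub0r hC.
    - by apply/measurable_EFinP; exact: measurable_funD.
  have f1 : \int[sigma]_x (f x)%:E = 1.
    transitivity (\int[rho]_x (cst 1 x)); last first.
      by rewrite integral_cst// mul1e; exact: rho1.
    by rewrite rhof//; apply: eq_integral => x _; rewrite mul1e.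
  have c0 x : (0 <= clamp n (f x))%R by rewrite ltW ?clamp_gt0.
  have -> : \int[sigma]_x ((ln (clamp n (f x)) + C)%:E * (f x)%:E) + 1 =
      \int[sigma]_x F n x + \int[sigma]_x (clamp n (f x))%:E + C%:E.
    have -> : C%:E = \int[sigma]_x (C * f x)%:E :> \bar R.
      under eq_integral do rewrite EFinM.
      rewrite ge0_integralZl_EFin ?f1 ?mule1//.
      - by move=> x _; rewrite lee_fin.
      - exact/measurable_EFinP.
    have -> : 1 = \int[sigma]_x (1 : R)%:E.
      by rewrite integral_cst// mul1e; exact/esym/probability_setT.
    rewrite -!ge0_integralD//.
    - apply: eq_integral => x _; rewrite /F -EFinM -!EFinD; congr EFin; lra.
    - by move=> x _; rewrite adde_ge0// lee_fin.
    - by apply: emeasurable_funD => //; apply/measurable_EFinP.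
    - by move=> x _; rewrite lee_fin mulr_ge0.
    - by apply/measurable_EFinP; exact: measurable_funM.
    - by move=> x _; rewrite lee_fin.
    - exact/measurable_EFinP.
    - by move=> x _; rewrite -EFinM lee_fin mulr_ge0// -lerBlDr sub0r.
    - apply/measurable_EFinP; apply: measurable_funM => //.
      exact: measurable_funD.
  rewrite leeD2rE// leeD2rE//.
  rewrite ge0_fin_numE; last by apply: integral_ge0 => x _; rewrite lee_fin.
  apply: (@le_lt_trans _ _ (\int[sigma]_x (n.+1%:R : R)%:E)).
    apply: ge0_le_integral => //; first by move=> x _; rewrite lee_fin.
    - exact/measurable_EFinP.
    - by move=> x _; rewrite lee_fin clamp_le.
  rewrite integral_cst// [X in _ * X](_ : _ = 1) ?mule1 ?ltry//.
  exact: probability_setT.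
have Fcvg x : F ^~ x @ \oo --> (KL_integrand (f x))%:E.
  by apply: cvg_EFin; [exact: nearW|exact: clamp_gap_cvg].
under eq_integral => x _ do rewrite -(cvg_limn_einf_sup (Fcvg x)).1.
apply: (le_trans (fatou _ measurableT mF _)) => //.
rewrite limn_einf_lim; apply: lime_le; first exact: is_cvg_einfs.
apply: nearW => n; apply: (@le_trans _ _ (\int[sigma]_x F n x)); last exact: FK.
by apply: ereal_inf_lbound; exists n => //=.
Qed.

End kl_duality.

(** * Mixtures and kernels *)

Section constant_kernel.
Context d d' (S : measurableType d) (T : measurableType d') (R : realType).
Variable rho : {measure set T -> \bar R}.
Hypothesis rhooo : (rho setT < +oo)%E.

Definition constant_kernel (_ : (rho setT < +oo)%E) (_ : S) :
  {measure set T -> \bar R} := rho.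

Let measurable_constant_kernel U : measurable U ->
  measurable_fun setT (constant_kernel rhooo ^~ U).
Proof. by move=> _; exact: measurable_cst. Qed.

HB.instance Definition _ := isKernel.Build _ _ _ _ _
  (constant_kernel rhooo) measurable_constant_kernel.

Let constant_kernel_uub : measure_fam_uub (constant_kernel rhooo).
Proof.
exists (fine (rho setT) + 1) => x; rewrite /constant_kernel.
by rewrite EFinD fineK ?ge0_fin_numE// lteDl// ge0_fin_numE.
Qed.

HB.instance Definition _ := Kernel_isFinite.Build _ _ _ _ _
  (constant_kernel rhooo) constant_kernel_uub.

End constant_kernel.

Lemma measureI_full d (T : measurableType d) (R : realType)
    (m : {measure set T -> \bar R}) (D U : set T) :
  (m setT < +oo)%E -> measurable D -> m D = m setT -> measurable U ->
  m (U `&` D) = m U.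
Proof.
move=> mfin mD mDT mU.
have mC : m (~` D) = 0%E.
  by rewrite -setTD measureD// setTI [X in (_ - X)%E]mDT subee// ge0_fin_numE.
rewrite [RHS](measureDI m mU mD) [X in (_ = X + _)%E](_ : _ = 0%E) ?add0e//.
apply/eqP; rewrite -measure_le0 -mC le_measure ?inE//.
- exact: measurableD.
- exact: measurableC.
Qed.

Section mixture.
Local Open Scope ereal_scope.
Context dZ dW d1 d2 (Z : measurableType dZ) (W : measurableType dW)
  (V1 : measurableType d1) (V2 : measurableType d2) (R : realType).

(* [M] is the law of [phi (z, w)] for [z] of law [rho] and [w] of law [k z];
   it suffices to check this on the rectangles over a set that carries [M]. *)
Lemma integral_mixture (rho : {measure set Z -> \bar R}) (k : R.-pker Z ~> W)
    (phi : Z * W -> V1 * V2) (M : {measure set (V1 * V2) -> \bar R})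
    (D : set V1) :
  rho setT < +oo -> measurable_fun setT phi -> measurable D ->
  M setT = rho setT -> M (D `*` setT) = M setT ->
  (forall A B, measurable A -> measurable B -> A `<=` D ->
    M (A `*` B) = \int[rho]_z k z [set w | (A `*` B) (phi (z, w))]) ->
  forall h : V1 * V2 -> \bar R, (forall v, 0 <= h v) ->
    measurable_fun setT h ->
    \int[M]_v h v = \int[rho]_z \int[k z]_w h (phi (z, w)).
Proof.
move=> rhooo mphi mD M1 MD Mrect h h0 mh.
pose phi' (x : (unit * Z) * W) := phi (x.1.2, x.2).
have mphi' : measurable_fun setT phi'.
  apply: (measurableT_comp mphi); apply: measurable_fun_pair => //.
  exact: (measurableT_comp measurable_snd measurable_fst).
pose l : R.-sfker unit ~> Z := constant_kernel rhooo.
pose kd : R.-sfker ((unit * Z) * W)%type ~> (V1 * V2)%type := kdirac mphi'.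
pose K : R.-sfker (unit * Z)%type ~> (V1 * V2)%type :=
  mkcomp (kernel.kernel_snd k) (kdirac mphi').
pose M' : {measure set (V1 * V2) -> \bar R} := mkcomp l K tt.
have intK z (g : V1 * V2 -> \bar R) : (forall v, 0 <= g v) ->
    measurable_fun setT g ->
    \int[K (tt, z)]_v g v = \int[k z]_w g (phi (z, w)).
  move=> g0 mg; rewrite integral_kcomp//; apply: eq_integral => w _.
  by rewrite integral_dirac// diracT mul1e.
have intM' (g : V1 * V2 -> \bar R) : (forall v, 0 <= g v) ->
    measurable_fun setT g ->
    \int[M']_v g v = \int[rho]_z \int[k z]_w g (phi (z, w)).
  move=> g0 mg; rewrite integral_kcomp//; apply: eq_integral => z _.
  exact: intK.
have M'E U : measurable U -> M' U = \int[rho]_z k z [set w | U (phi (z, w))].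
  move=> mU; transitivity (\int[M']_v (\1_U v)%:E).
    by rewrite integral_indic// setIT.
  rewrite intM'//; last exact/measurable_EFinP.
  apply: eq_integral => z _; transitivity
    (\int[k z]_w (\1_[set w | U (phi (z, w))] w)%:E) => //.
  rewrite integral_indic ?setIT// -[X in measurable X]setTI.
  exact: (measurableT_comp mphi (measurable_pair1 z)).
have M'T : M' setT = rho setT.
  rewrite M'E// -[RHS]mul1e -integral_cst//; apply: eq_integral => z _.
  exact: prob_kernel.
have M'D : M' (D `*` setT) = M' setT.
  by rewrite M'T -M1 -MD Mrect// M'E//; exact: measurableX.
have Moo : M setT < +oo by rewrite M1.
have M'oo : M' setT < +oo by rewrite M'T.
have mDT : measurable (D `*` [set: V2]) by exact: measurableX.
pose C : set (set (V1 * V2)) :=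
  [set A `*` B | A in measurable & B in measurable].
have CI : setI_closed C.
  move=> _ _ [A1 mA1 [B1 mB1 <-]] [A2 mA2 [B2 mB2 <-]].
  by rewrite -setXI; exists (A1 `&` A2); [exact: measurableI|];
    exists (B1 `&` B2) => //; exact: measurableI.
rewrite -intM'//; apply: eq_measure_integral => U mU _.
apply: (measure_unique C (fun=> setT)) => //.
- exact: measurable_prod_measurableType.
- by move=> _; exists setT => //; exists setT => //; rewrite setXTT.
- by rewrite bigcup_const.
- move=> _ [A mA [B mB <-]].
  have mAB : measurable (A `*` B) by exact: measurableX.
  have mAD : measurable (A `&` D) by exact: measurableI.
  transitivity (M ((A `*` B) `&` (D `*` setT))).
    exact/esym/measureI_full.
  transitivity (M' ((A `*` B) `&` (D `*` setT))); last first.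
    exact: measureI_full.
  by rewrite -setXI setIT Mrect// M'E//; exact: measurableX.
Qed.

End mixture.

Section young_mixture.
Local Open Scope ereal_scope.
Context dZ dW dV (Z : measurableType dZ) (W : measurableType dW)
  (V : measurableType dV) (R : realType).
Variables (k : R.-pker Z ~> W) (phi : Z * W -> V).
Hypothesis mphi : measurable_fun setT phi.

Definition law_of_mixture (rho : {measure set Z -> \bar R})
    (rho' : {measure set V -> \bar R}) :=
  forall h : V -> \bar R, (forall v, 0 <= h v) -> measurable_fun setT h ->
    \int[rho']_v h v = \int[rho]_z \int[k z]_w h (phi (z, w)).

Lemma young_mixture (rho sigma : {measure set Z -> \bar R})
    (rho' sigma' : {measure set V -> \bar R}) (f : Z -> R) (C : R)
    (h : V -> R) :
  measurable_fun setT f -> (forall z, (0 <= f z)%R) ->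
  (forall H : Z -> \bar R, (forall z, 0 <= H z) -> measurable_fun setT H ->
    \int[rho]_z H z = \int[sigma]_z (H z * (f z)%:E)) ->
  rho setT = 1 -> sigma setT = 1 ->
  law_of_mixture rho rho' -> law_of_mixture sigma sigma' ->
  (0 <= C)%R -> measurable_fun setT h -> (forall v, (- C <= h v)%R) ->
  \int[rho']_v (h v + C)%:E + 1 <=
  \int[sigma]_z (KL_integrand (f z))%:E + \int[sigma']_v (expR (h v))%:E + C%:E.
Proof.
move=> mf f0 rhof rho1 sigma1 mixr mixs C0 mh hC.
have hC0 v : (0 <= h v + C)%R by rewrite -lerBlDr sub0r.
have mhC : measurable_fun setT (fun v => h v + C)%R by exact: measurable_funD.
have meh : measurable_fun setT (expR \o h) by exact: measurableT_comp.
have mKLf : measurable_fun setT (fun z => (KL_integrand (f z))%:E).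
  apply/measurable_EFinP; apply: measurableT_comp => //.
  exact: measurable_KL_integrand.
have mphiz z : measurable_fun setT (fun w => phi (z, w)).
  exact: (measurableT_comp mphi (measurable_pair1 z)).
have mhz z : measurable_fun setT (fun w => (h (phi (z, w)) + C)%:E).
  by apply/measurable_EFinP; exact: (measurableT_comp mhC).
have mez z : measurable_fun setT (fun w => (expR (h (phi (z, w))))%:E).
  by apply/measurable_EFinP; exact: (measurableT_comp meh).
pose a z := \int[k z]_w (h (phi (z, w)) + C)%:E.
pose e z := \int[k z]_w (expR (h (phi (z, w))))%:E.
have a0 z : 0 <= a z by apply: integral_ge0 => w _; rewrite lee_fin.
have e0 z : 0 <= e z.
  by apply: integral_ge0 => w _; rewrite lee_fin expR_ge0.
have ma : measurable_fun setT a.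
  apply: (@measurable_kfcomp _ _ _ _ _ k
    (fun x => (h (phi (x.1, x.2)) + C)%:E)).
    apply/measurable_EFinP; apply: (measurableT_comp mhC).
    by apply: eq_measurable_fun mphi => -[].
  by move=> x; rewrite lee_fin.
have me : measurable_fun setT e.
  apply: (@measurable_kfcomp _ _ _ _ _ k
    (fun x => (expR (h (phi (x.1, x.2))))%:E)).
    apply/measurable_EFinP; apply: (measurableT_comp meh).
    by apply: eq_measurable_fun mphi => -[].
  by move=> x; rewrite lee_fin expR_ge0.
have cstE d (U : measurableType d) (m : {measure set U -> \bar R}) :
    m setT = 1 -> \int[m]_z (1 : R)%:E = 1.
  by move=> m1; rewrite integral_cst// mul1e.
have f1 : \int[sigma]_z (f z)%:E = 1.
  rewrite -(cstE _ _ rho rho1) rhof//.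
  by apply: eq_integral => z _; rewrite mul1e.
have fE : C%:E = \int[sigma]_z (C%:E * (f z)%:E).
  rewrite ge0_integralZl_EFin ?f1 ?mule1//; last exact/measurable_EFinP.
  by move=> z _; rewrite lee_fin.
have -> : \int[rho']_v (h v + C)%:E = \int[sigma]_z (a z * (f z)%:E).
  by rewrite mixr ?rhof//; exact/measurable_EFinP.
have -> : \int[sigma']_v (expR (h v))%:E = \int[sigma]_z e z.
  by rewrite mixs//; exact/measurable_EFinP.
rewrite -[X in _ + X](cstE _ _ sigma sigma1) [X in _ <= _ + X]fE.
have maf : measurable_fun setT (fun z => a z * (f z)%:E).
  by apply: emeasurable_funM => //; exact/measurable_EFinP.
have mCf : measurable_fun setT (fun z => C%:E * (f z)%:E).
  by apply: emeasurable_funM => //; exact/measurable_EFinP.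
have af0 z : 0 <= a z * (f z)%:E by rewrite mule_ge0// lee_fin.
have Cf0 z : 0 <= C%:E * (f z)%:E by rewrite mule_ge0// lee_fin.
have KL0 z : 0 <= (KL_integrand (f z))%:E by rewrite lee_fin KL_integrand_ge0.
rewrite -!ge0_integralD//; last 2 first.
- by move=> z _; rewrite adde_ge0//.
- exact: emeasurable_funD.
apply: ge0_le_integral => //.
- by move=> z _; rewrite adde_ge0//.
- exact: emeasurable_funD.
- by apply: emeasurable_funD => //; exact: emeasurable_funD.
move=> z _; rewrite /a /e.
have k1 : k z setT = 1 by exact: prob_kernel.
rewrite muleC -ge0_integralZl_EFin//; last by move=> w _; rewrite lee_fin.
rewrite -[X in _ + X](cstE _ _ (k z) k1) -ge0_integralD//; last 2 first.
- by move=> w _; rewrite mule_ge0// lee_fin.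
- exact: emeasurable_funM.
rewrite [leRHS](_ : _ = \int[k z]_w
    ((KL_integrand (f z) + C * f z)%:E + (expR (h (phi (z, w))))%:E)).
  apply: ge0_le_integral => //.
  - by move=> w _; rewrite adde_ge0// mule_ge0// lee_fin.
  - by apply: emeasurable_funD => //; exact: emeasurable_funM.
  - exact: emeasurable_funD.
  move=> w _; rewrite -EFinM -!EFinD lee_fin.
  by have := KL_integrand_young (h (phi (z, w))) (f0 z); lra.
rewrite ge0_integralD//; last first.
  by move=> w _; rewrite lee_fin addr_ge0 ?mulr_ge0 ?KL_integrand_ge0.
rewrite integral_cst// k1 mule1 EFinD addeAC.
by rewrite EFinM.
Qed.

End young_mixture.

(** * Cells and gluing *)

Section finite_sums_of_measures.
Local Open Scope ereal_scope.
Context d (T : measurableType d) (R : realType).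

Lemma ge0_integral_weighted_sum (J : finType) (P : pred J) (w : J -> R)
    (m : J -> {measure set T -> \bar R}) (M : {measure set T -> \bar R}) :
  (forall j, P j -> 0 <= w j)%R ->
  (forall U, measurable U -> M U = \sum_(j | P j) (w j)%:E * m j U) ->
  forall h : T -> \bar R, (forall x, 0 <= h x) -> measurable_fun setT h ->
    \int[M]_x h x = \sum_(j | P j) (w j)%:E * \int[m j]_x h x.
Proof.
move=> w0 ME h h0 mh.
suff [M' M'E intM'] : exists2 M' : {measure set T -> \bar R},
    (forall U, measurable U -> M' U = \sum_(j | P j) (w j)%:E * m j U) &
    \int[M']_x h x = \sum_(j | P j) (w j)%:E * \int[m j]_x h x.
  by rewrite -intM'; apply: eq_measure_integral => U mU _; rewrite ME// M'E.
elim: (index_enum J) => [|j s [M' M'E intM']].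
  by exists mzero => [U mU|]; rewrite big_nil//; exact: integral_measure_zero.
have [Pj|Pj] := boolP (P j); last first.
  by exists M' => [U mU|]; rewrite big_cons (negbTE Pj)//; exact: M'E.
exists (measure_add (mscale (NngNum (w0 _ Pj)) (m j)) M') => [U mU|].
  by rewrite big_cons Pj -M'E//; exact: measure_addE.
by rewrite big_cons Pj ge0_integral_measure_add// ge0_integral_mscale// intM'.
Qed.

Lemma measureU_null (m : {measure set T -> \bar R}) (A B : set T) :
  measurable A -> measurable B -> m (A `&` B) = 0 -> m (A `|` B) = m A + m B.
Proof.
move=> mA mB mAB.
have -> : m B = m (B `\` A).
  by rewrite (measureDI m mB mA) [X in _ + X](_ : _ = 0) ?adde0// setIC.
rewrite -measureU//; first by rewrite setDE setUIr setUv setIT.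
  exact: measurableD.
by rewrite setDE setICA setICr setI0.
Qed.

Lemma measure_sum_almost_partition (J : finType) (S : J -> set T)
    (m : {measure set T -> \bar R}) :
  (forall j, measurable (S j)) -> \bigcup_j S j = setT ->
  (forall i j, i != j -> m (S i `&` S j) = 0) ->
  forall U, measurable U -> m U = \sum_j m (U `&` S j).
Proof.
move=> mS ST S0 U mU.
have null s j : j \notin s -> m (S j `&` \big[setU/set0]_(i <- s) S i) = 0.
  elim: s => [|i s ih]; first by rewrite big_nil setI0 measure0.
  rewrite inE negb_or big_cons setIUr => /andP[ji js].
  have mSs : measurable (\big[setU/set0]_(i <- s) S i).
    exact: bigsetU_measurable.
  apply/eqP; rewrite -measure_le0 (le_trans (measureU2 _ _ _))//.
  - exact: measurableI.
  - exact: measurableI.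
  by rewrite [X in X + _]S0// add0e [leLHS]ih.
suff ind s : uniq s ->
    m (U `&` \big[setU/set0]_(j <- s) S j) = \sum_(j <- s) m (U `&` S j).
  rewrite -ind ?index_enum_uniq// -bigcup_seq.
  rewrite [X in _ `&` X](_ : _ = setT) ?setIT//.
  rewrite -ST; apply: eq_bigcupl; split => j //= _.
  by rewrite mem_index_enum.
elim: s => [_|j s ih /= /andP[js us]]; first by rewrite !big_nil setI0 measure0.
have mSs : measurable (\big[setU/set0]_(i <- s) S i).
  exact: bigsetU_measurable.
rewrite !big_cons setIUr measureU_null//.
- by rewrite ih.
- exact: measurableI.
- exact: measurableI.
apply/eqP; rewrite -measure_le0 -(null _ _ js) le_measure// ?inE.
- by do 2! apply: measurableI => //.
- exact: measurableI.
- by move=> x [[_ ?] [_ ?]].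
Qed.

End finite_sums_of_measures.

Lemma lower_semicontinuous_measurable_prod (R : realType)
    (dX dY : measure_display)
    (X : borelMetricType R dX) (Y : borelMetricType R dY)
    (cptX : compact [set: X]) (cptY : compact [set: Y]) (f : X * Y -> \bar R) :
  lower_semicontinuous f -> measurable_fun setT f.
Proof.
move=> /lower_semicontinuousP lscf.
have [BX cBX [BXo BXb]] := @compact_second_countable R X cptX.
have [BY cBY [BYo BYb]] := @compact_second_countable R Y cptY.
have mopen (U : set (X * Y)) : open U -> measurable U.
  move=> oU; pose D := [set AB | (BX `*` BY) AB /\ AB.1 `*` AB.2 `<=` U].
  have [g gD] : exists g : nat -> set X * set Y, set_surj setT (BX `*` BY) g.
    by apply/pcard_surjP; exact: countableX.
  rewrite (_ : U = \bigcup_(n in [set n | D (g n)]) ((g n).1 `*` (g n).2)).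
    apply: bigcup_measurable => n [[/BXo oA /BYo oB] _]; apply: measurableX.
      by rewrite measurable_borelE; exact: sub_sigma_algebra.
    by rewrite measurable_borelE; exact: sub_sigma_algebra.
  apply/seteqP; split => [[x y] Uxy|[x y] [n [_ nU] xy]]; last exact: nU.
  have [[A B] /= [Ax By] ABU] := open_nbhs_nbhs (conj oU Uxy).
  have [A' [BA' A'x] A'A] := BXb _ _ Ax.
  have [B' [BB' B'y] B'B] := BYb _ _ By.
  have [n _ gn] := gD (A', B') (conj BA' BB').
  exists n; rewrite /= ?gn//; split => // -[u v] [/A'A Au /B'B Bv].
  exact: ABU.
apply: (measurability _ (ErealGenOInfty.measurableE R)).
move=> /= _ [_ [a ->]] <-; apply: measurableI => //; apply: mopen.
by rewrite preimage_itvoy; exact: lscf.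
Qed.

Section restricted_measures.
Local Open Scope ereal_scope.

Lemma ge0_integral_mrestr d (T : measurableType d) (R : realType)
    (m : {measure set T -> \bar R}) (D : set T) (mD : measurable D)
    (h : T -> \bar R) : (forall x, 0 <= h x) -> measurable_fun setT h ->
  \int[mrestr m mD]_x h x = \int[m]_(x in D) h x.
Proof.
move=> h0 mh.
have -> : \int[m]_(x in D) h x = \int[mrestr m mD]_(x in D) h x.
  by apply: eq_measure_integral => U mU UD; rewrite /= /mrestr setIidl.
rewrite -[in LHS](setUv D) ge0_integral_setU//; last 3 first.
- exact: measurableC.
- exact: measurable_funTS.
- exact/disj_setPCl.
rewrite [X in _ + X]null_set_integral ?adde0//.
- exact: measurableC.
- exact: measurable_funTS.
- by transitivity (m (~` D `&` D)) => //; rewrite setIC setICr measure0.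
Qed.

Lemma integral_marginal1 d1 d2 (T1 : measurableType d1) (T2 : measurableType d2)
    (R : realType) (pi : {measure set (T1 * T2) -> \bar R})
    (rho : {measure set T1 -> \bar R}) (D : set T1) (h : T1 -> \bar R) :
  (forall A, measurable A -> marginal1 pi A = rho A) ->
  \int[marginal1 pi]_(x in D) h x = \int[rho]_(x in D) h x.
Proof.
move=> pirho; rewrite (eq_measure_integral rho)// => A mA _; exact: pirho.
Qed.

Lemma integral_disintegration d1 d2 (T1 : measurableType d1)
    (T2 : measurableType d2) (R : realType)
    (pi : {measure set (T1 * T2) -> \bar R}) (rho : {measure set T1 -> \bar R})
    (k : R.-pker T1 ~> T2) :
  rho setT < +oo -> (forall A, measurable A -> marginal1 pi A = rho A) ->
  disintegration pi k ->
  forall h : T1 * T2 -> \bar R, (forall z, 0 <= h z) -> measurable_fun setT h ->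
    \int[pi]_z h z = \int[rho]_x \int[k x]_y h (x, y).
Proof.
move=> rhooo pirho pik.
apply: (@integral_mixture _ _ _ _ _ _ _ _ _ rho k id pi setT) => //.
- by rewrite -pirho.
- by rewrite setXTT.
move=> A B mA mB _; rewrite pik// (integral_marginal1 _ _ pirho).
rewrite integral_mkcond; apply: eq_integral => x _; rewrite patchE.
case: ifPn => [/set_mem Ax|/negP Ax].
  by congr (k x _); apply/seteqP; split => // y [].
rewrite [X in k x X](_ : _ = set0) ?measure0//.
by apply/seteqP; split => // y [/= /mem_set].
Qed.

End restricted_measures.

Section kernel_fst.
Context d1 d2 d3 (T1 : measurableType d1) (T2 : measurableType d2)
  (W : measurableType d3) (R : realType) (k : R.-pker T1 ~> W).

Definition kernel_fst : T1 * T2 -> {measure set W -> \bar R} := k \o fst.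

Let measurable_kernel_fst U : measurable U ->
  measurable_fun setT (kernel_fst ^~ U).
Proof.
move=> mU.
exact: (measurableT_comp (measurable_kernel k U mU) measurable_fst).
Qed.

HB.instance Definition _ := isKernel.Build _ _ _ _ _ kernel_fst
  measurable_kernel_fst.

Let kernel_fst_prob z : kernel_fst z setT = 1%E.
Proof. exact: prob_kernel. Qed.

HB.instance Definition _ := Kernel_isProbability.Build _ _ _ _ _ kernel_fst
  kernel_fst_prob.

End kernel_fst.

Section cells.
Local Open Scope ereal_scope.
Context (R : realType) (dX dY : measure_display).
Context (X : borelMetricType R dX) (Y : borelMetricType R dY).
Context (mu : probability X R) (I : finType) (P : basic_partition mu I).
Implicit Types (m : {measure set (X * Y) -> \bar R}) (i j : I).

Lemma massE i : mu (P i) = (mass P i)%:E.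
Proof. by rewrite /mass fineK// fin_num_measure//; exact: cell_measurable. Qed.

Lemma mass_gt0 i : (0 < mass P i)%R.
Proof. by rewrite -lte_fin -massE; exact: cell_mass_gt0. Qed.

Lemma mass_inv_ge0 i : (0 <= (mass P i)^-1)%R.
Proof. by rewrite invr_ge0 ltW ?mass_gt0. Qed.

Lemma massVK i (x : \bar R) : (mass P i)%:E * ((mass P i)^-1%:E * x) = x.
Proof. by rewrite muleA -EFinM divff ?mul1e// gt_eqF ?mass_gt0. Qed.

Definition cell_cond m i : {measure set (X * Y) -> \bar R} :=
  mscale (NngNum (mass_inv_ge0 i)) (mrestr m (strip_measurable P i)).

Lemma ge0_integral_cell_cond m i (h : X * Y -> \bar R) :
  (forall z, 0 <= h z) -> measurable_fun setT h ->
  \int[cell_cond m i]_z h z =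
  (mass P i)^-1%:E * \int[m]_(z in P i `*` setT) h z.
Proof.
by move=> h0 mh; rewrite ge0_integral_mscale//= ge0_integral_mrestr.
Qed.

Lemma cell_cond_density m m' (f : X * Y -> R) i :
  measurable_fun setT f -> (forall z, (0 <= f z)%R) ->
  (forall h, (forall z, 0 <= h z) -> measurable_fun setT h ->
    \int[m]_z h z = \int[m']_z (h z * (f z)%:E)) ->
  forall h, (forall z, 0 <= h z) -> measurable_fun setT h ->
    \int[cell_cond m i]_z h z = \int[cell_cond m' i]_z (h z * (f z)%:E).
Proof.
move=> mf f0 mE h h0 mh.
have mS : measurable (P i `*` [set: Y]) by exact: strip_measurable.
rewrite !ge0_integral_cell_cond//; last 2 first.
- by move=> z; rewrite mule_ge0// lee_fin.
- by apply: emeasurable_funM => //; exact/measurable_EFinP.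
congr (_ * _); rewrite integral_mkcond [RHS]integral_mkcond mE; last 2 first.
- by move=> z; exact: erestrict_ge0.
- exact: (iffLR (measurable_restrictT h mS) (measurable_funTS mh)).
apply: eq_integral => z _; rewrite !patchE.
by case: ifPn => // _; rewrite mul0e.
Qed.

Section first_marginal_mu.
Variable m : {measure set (X * Y) -> \bar R}.
Hypothesis m_mu : forall A, measurable A -> marginal1 m A = mu A.

Lemma strip_mass i : m (P i `*` setT) = (mass P i)%:E.
Proof. by rewrite setXT; rewrite -massE -m_mu//; exact: cell_measurable. Qed.

Lemma cell_cond_setT i : cell_cond m i setT = 1.
Proof.
transitivity ((mass P i)^-1%:E * m (setT `&` (P i `*` setT))) => //.
by rewrite setTI strip_mass -EFinM mulVf// gt_eqF ?mass_gt0.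
Qed.

Lemma cell_cond_sum U : measurable U ->
  m U = \sum_i (mass P i)%:E * cell_cond m i U.
Proof.
move=> mU.
pose S i := P i `*` [set: Y].
rewrite (measure_sum_almost_partition (S := S) _ _ _ mU).
- by apply: eq_bigr => i _; exact/esym/massVK.
- by move=> i; exact: strip_measurable.
- by rewrite -setX_bigcupl cell_cover setXTT.
move=> i j ij; rewrite -setXI setTI setXT.
transitivity (mu (P i `&` P j)); last exact: cell_disjoint.
by rewrite -m_mu//; apply: measurableI; exact: cell_measurable.
Qed.

Lemma ge0_integral_cell_sum (h : X * Y -> \bar R) :
  (forall z, 0 <= h z) -> measurable_fun setT h ->
  \int[m]_z h z = \sum_i (mass P i)%:E * \int[cell_cond m i]_z h z.
Proof.
move=> h0 mh; apply: (ge0_integral_weighted_sum (P := predT)) => //.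
  by move=> i _; rewrite ltW ?mass_gt0.
exact: cell_cond_sum.
Qed.

End first_marginal_mu.

End cells.

Section gluing.
Local Open Scope ereal_scope.
Context (R : realType) (dX dY : measure_display).
Context (X : borelMetricType R dX) (Y : borelMetricType R dY).
Context (mu : probability X R) (nu : probability Y R).
Context (I : finType) (P : basic_partition mu I).
Variables (k : R.-pker X ~> X).

Lemma product_marginal1 A : measurable A ->
  marginal1 (product_probability mu nu) A = mu A.
Proof.
move=> mA; rewrite /marginal1 /pushforward -setXT.
transitivity (mu A * nu setT); first exact: product_measure1E.
by rewrite probability_setT mule1.
Qed.

Definition replace_fst (u : (X * Y) * X) : X * Y := (u.2, u.1.2).

Lemma measurable_replace_fst : measurable_fun setT replace_fst.
Proof.
apply: measurable_fun_pair => //.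
exact: (measurableT_comp measurable_snd measurable_fst).
Qed.

Lemma kernel_replace_fst (A : set X) (B : set Y) (z : X * Y) :
  kernel_fst k z [set x | (A `*` B) (replace_fst (z, x))] =
  k z.1 A * (\1_B z.2)%:E.
Proof.
rewrite indicE; case: (boolP (z.2 \in B)) => [/set_mem Bz|/negP Bz].
  by rewrite mule1; congr (k z.1 _); apply/seteqP; split => // x [].
rewrite mule0 [X in kernel_fst k z X](_ : _ = set0) ?measure0//.
by apply/seteqP; split => // x [_ /= /mem_set].
Qed.

Lemma measurable_kernel_replace_fst (A : set X) (B : set Y) :
  measurable A -> measurable B ->
  measurable_fun setT (fun z : X * Y => k z.1 A * (\1_B z.2)%:E).
Proof.
move=> mA mB; apply: emeasurable_funM.
  exact: (measurableT_comp (measurable_kernel k A mA) measurable_fst).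
apply/measurable_EFinP.
by apply: (measurableT_comp _ measurable_snd); exact: measurable_indic.
Qed.

Lemma cell_marginal1 (m : {measure set (X * Y) -> \bar R}) i :
  (forall A, measurable A -> marginal1 m A = mu A) ->
  forall A, measurable A -> marginal1 (pi_ P m i) A = mu_ P i A.
Proof.
move=> m_mu A mA; rewrite /marginal1 /pushforward /pi_ /mrestr.
rewrite [X in m X](_ : _ = fst @^-1` (A `&` P i)); last first.
  by apply/seteqP; split => -[x y] /=; rewrite /setX /= /setT /=; tauto.
by apply: m_mu; apply: measurableI => //; exact: cell_measurable.
Qed.

Lemma gluing_law (pi : {measure set (X * Y) -> \bar R})
    (pij : {measure set (X * Y) -> \bar R}) (kpi : R.-pker X ~> Y) i j :
  (forall A, measurable A -> marginal1 pi A = mu A) ->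
  edge_candidate P pi i j pij ->
  disintegration (pi_ P pi i) kpi ->
  (forall A B, measurable A -> measurable B -> A `<=` P j ->
    pij (A `*` B) = (mass P i)^-1%:E *
      \int[mu_ P i]_(x in P i) (k x A * kpi x B)) ->
  law_of_mixture (kernel_fst k) replace_fst (cell_cond P pi i) pij.
Proof.
move=> pi_mu [pij1 _] kpiE pijE.
have mPj : measurable (P j) by exact: cell_measurable.
have mPi : measurable (P i) by exact: cell_measurable.
have pijT : pij setT = 1.
  transitivity (marginal1 pij setT) => //; rewrite pij1//.
  transitivity ((mass P j)^-1%:E * mu (setT `&` P j)) => //.
  by rewrite setTI massE -EFinM mulVf// gt_eqF ?mass_gt0.
have cT := cell_cond_setT P pi_mu i.
apply: (@integral_mixture _ _ _ _ _ _ _ _ _ _ _ _ _ (P j)) => //.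
- by rewrite cT ltry.
- exact: measurable_replace_fst.
- by rewrite pijT cT.
- rewrite pijT; transitivity (marginal1 pij (P j)).
    by rewrite /marginal1 /pushforward setXT.
  rewrite pij1//; transitivity ((mass P j)^-1%:E * mu (P j `&` P j)) => //.
  by rewrite setIid massE -EFinM mulVf// gt_eqF ?mass_gt0.
move=> A B mA mB APj; rewrite pijE//.
under [RHS]eq_integral do rewrite kernel_replace_fst.
have u0 z : 0 <= k z.1 A * (\1_B z.2)%:E by rewrite mule_ge0// lee_fin.
have mu' := measurable_kernel_replace_fst mA mB.
rewrite ge0_integral_mscale//; congr (_ * _).
have muooo : mrestr mu (cell_measurable P i) setT < +oo.
  apply: (@le_lt_trans _ _ (mu (setT `&` P i))) => //.
  by rewrite setTI massE ltry.
rewrite (integral_disintegration muooo (cell_marginal1 i pi_mu) kpiE)//.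
have kk x : \int[kpi x]_y (k (x, y).1 A * (\1_B (x, y).2)%:E) = k x A * kpi x B.
  rewrite /= ge0_integralZl// ?integral_indic ?setIT//.
  exact/measurable_EFinP.
under [RHS]eq_integral do rewrite kk.
rewrite [RHS]ge0_integral_mrestr.
- by apply: eq_measure_integral => U mU UP;
    transitivity (mu (U `&` P i)) => //; rewrite setIidl.
- by move=> x; rewrite mule_ge0.
- by apply: emeasurable_funM; exact: measurable_kernel.
Qed.

Lemma gluing_law_product (gamma : {measure set (X * X) -> \bar R}) i j :
  coupling (scaled (mass P i)^-1 (mu_ P i)) (scaled (mass P j)^-1 (mu_ P j))
    gamma ->
  disintegration gamma k ->
  law_of_mixture (kernel_fst k) replace_fst
    (cell_cond P (product_probability mu nu) i)
    (cell_cond P (product_probability mu nu) j).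
Proof.
move=> [gamma1 gamma2] gammak.
have mPj : measurable (P j) by exact: cell_measurable.
have mPi : measurable (P i) by exact: cell_measurable.
set sigma := product_probability mu nu.
have sigma_mu := product_marginal1.
have ci := cell_cond_setT P sigma_mu i.
have cj := cell_cond_setT P sigma_mu j.
apply: (@integral_mixture _ _ _ _ _ _ _ _ _ _ _ _ _ setT) => //.
- by rewrite ci ltry.
- exact: measurable_replace_fst.
- by rewrite ci cj.
- by rewrite setXTT.
move=> A B mA mB _.
under [RHS]eq_integral do rewrite kernel_replace_fst.
have u0 z : 0 <= k z.1 A * (\1_B z.2)%:E by rewrite mule_ge0// lee_fin.
have mu' := measurable_kernel_replace_fst mA mB.
rewrite ge0_integral_cell_cond//.
transitivity ((mass P j)^-1%:E * (mu (A `&` P j) * nu B)).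
  congr (_ * _); transitivity (sigma ((A `*` B) `&` (P j `*` setT))) => //.
  rewrite -setXI setIT.
  by apply: product_measure1E => //; exact: measurableI.
have kA : (mass P i)^-1%:E * \int[mu]_(x in P i) k x A =
    (mass P j)^-1%:E * mu (A `&` P j).
  transitivity (gamma (setT `*` A)); last first.
    by rewrite setTX; exact: gamma2.
  rewrite gammak//.
  pose mui : {measure set X -> \bar R} :=
    mscale (NngNum (mass_inv_ge0 P i)) (mrestr mu (cell_measurable P i)).
  rewrite (integral_marginal1 (rho := mui))//.
  have mkA := measurable_kernel k A mA.
  rewrite ge0_integral_mscale//; congr (_ * _).
  by rewrite ge0_integral_mrestr.
rewrite muleA -kA -muleA; congr (_ * _).
rewrite [RHS]integral_mkcond.
rewrite (_ : _ \_ _ = fun z =>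
    (k z.1 A * (\1_(P i) z.1)%:E) * (\1_B z.2)%:E); last first.
  apply/funext => -[x y]; rewrite patchE /= !indicE.
  have [Px|Px] := boolP (x \in P i).
    by rewrite mule1 ifT// inE; split => //; exact: set_mem.
  rewrite mule0 mul0e ifF//; apply/negP => /set_mem[/= Px' _].
  by move/negP: Px; apply; exact: mem_set.
have mk : measurable_fun setT (fun x => k x A * (\1_(P i) x)%:E).
  apply: emeasurable_funM; first exact: measurable_kernel.
  exact/measurable_EFinP.
have k0 x : 0 <= k x A * (\1_(P i) x)%:E by rewrite mule_ge0// lee_fin.
have mB' : measurable_fun setT (fun y : Y => (\1_B y : R)%:E).
  exact/measurable_EFinP.
transitivity (\int[mu]_x \int[nu]_y
    (k x A * (\1_(P i) x)%:E * (\1_B y)%:E)); last first.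
  rewrite [RHS]fubini_tonelli1//.
  apply: emeasurable_funM; first exact: (measurableT_comp mk measurable_fst).
  exact: (measurableT_comp mB' measurable_snd).
under [RHS]eq_integral.
  move=> x _; rewrite ge0_integralZl//.
  rewrite integral_indic// setIT.
  over.
rewrite /= ge0_integralZr// [in LHS]integral_mkcond; congr (_ * _).
apply: eq_integral => x _; rewrite patchE indicE.
by case: ifPn => _; rewrite ?mule1 ?mule0.
Qed.

End gluing.

(** * Flows *)

Section flows.
Context (R : realType) (dX : measure_display) (X : borelMetricType R dX).
Context (mu : {measure set X -> \bar R}) (I : finType).
Context (P : basic_partition mu I) (N : {set I * I}) (w : I -> I -> R).
Hypothesis flow_w : mass_preserving_flow P N w.

Lemma flow_sum_fst (F : I -> \bar R) : (forall i, 0 <= F i)%E ->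
  (\sum_(p in N) (w p.1 p.2)%:E * F p.1 = \sum_i (mass P i)%:E * F i)%E.
Proof.
move=> F0; have [w0 wN] := flow_w.
rewrite [RHS](eq_bigr (fun i => \sum_(j | (i, j) \in N) (w i j)%:E * F i)%E).
  by rewrite pair_big_dep/=; apply: eq_bigl => -[i j].
move=> i _; rewrite -ge0_sume_distrl; last by move=> j ijN; rewrite lee_fin w0.
by rewrite sumEFin (wN i).1.
Qed.

Lemma flow_sum_snd (F : I -> \bar R) :
  neighborhood_set N -> (forall i, 0 <= F i)%E ->
  (\sum_(p in N) (w p.1 p.2)%:E * F p.2 = \sum_j (mass P j)%:E * F j)%E.
Proof.
move=> [_ symN] F0; have [w0 wN] := flow_w.
rewrite [RHS](eq_bigr (fun j => \sum_(i | (j, i) \in N) (w i j)%:E * F j)%E).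
  rewrite (exchange_big_dep predT)//= pair_big_dep/=.
  by apply: eq_bigl => -[i j]; rewrite /= symN.
move=> j _; rewrite -ge0_sume_distrl; last first.
  by move=> i jiN; rewrite lee_fin w0// symN.
by rewrite sumEFin (wN j).2.
Qed.

Lemma diagonal_flow : (forall i, (i, i) \in N) ->
  mass_preserving_flow P N (fun i j => if i == j then mass P i else 0).
Proof.
move=> Nii; split=> [i j _|i].
  by case: ifP => // _; rewrite fine_ge0.
split; rewrite (bigD1 i)//= eqxx big1 ?addr0// => j /andP[_ ji].
  by rewrite eq_sym (negbTE ji).
by rewrite (negbTE ji).
Qed.

Lemma min_cost_flow_le (r : I -> I -> R) :
  (forall i, (i, i) \in N) ->
  min_cost_flow P N (fun i j => r i j - r i i) w ->
  \sum_(p in N) w p.1 p.2 * r p.1 p.2 <= \sum_(p in N) w p.1 p.2 * r p.1 p.1.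
Proof.
move=> Nii [_ /(_ _ (diagonal_flow Nii))]; rewrite /flow_cost.
rewrite [leRHS]big1; last first.
  by move=> [i j] _ /=; case: eqP => [->|_]; rewrite ?subrr ?mulr0 ?mul0r.
under eq_bigr do rewrite mulrBr.
by rewrite sumrB subr_le0.
Qed.

End flows.

Section edges.
Local Open Scope ereal_scope.
Context (R : realType) (dX dY : measure_display).
Context (X : borelMetricType R dX) (Y : borelMetricType R dY).
Context (mu : probability X R) (nu : probability Y R).
Context (I : finType) (P : basic_partition mu I).
Implicit Types (f : X * Y -> R) (i j : I).
Variable pi : {measure set (X * Y) -> \bar R}.
Hypothesis pi_mu : forall A, measurable A -> marginal1 pi A = mu A.

Definition edge_young (f : X * Y -> R) i j
    (pij : {measure set (X * Y) -> \bar R}) :=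
  forall (C : R) (h : X * Y -> R), (0 <= C)%R ->
    measurable_fun setT h -> (forall z, (- C <= h z)%R) ->
    \int[pij]_z (h z + C)%:E + 1 <=
    \int[cell_cond P (product_probability mu nu) i]_z (KL_integrand (f z))%:E +
    \int[cell_cond P (product_probability mu nu) j]_z (expR (h z))%:E + C%:E.

Lemma edge_young_diag f i (pii : {measure set (X * Y) -> \bar R}) :
  measurable_fun setT f -> (forall z, (0 <= f z)%R) ->
  (forall H : X * Y -> \bar R, (forall z, 0 <= H z) -> measurable_fun setT H ->
    \int[pi]_z H z =
    \int[product_probability mu nu]_z (H z * (f z)%:E)) ->
  (forall U, measurable U -> pii U = cell_cond P pi i U) ->
  edge_young f i i pii.
Proof.
move=> mf f0 pif piiE C h C0 mh hC.
have law (m m' : {measure set (X * Y) -> \bar R}) :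
    (forall U, measurable U -> m' U = m U) ->
    law_of_mixture (kdirac (@measurable_id _ (X * Y)%type setT)) snd m m'.
  move=> m'm g g0 mg.
  rewrite (eq_measure_integral m) => [|U mU _]; last exact: m'm.
  apply: eq_integral => z _.
  by rewrite integral_dirac// diracT mul1e.
have dens := cell_cond_density P i mf f0 pif.
pose k := kdirac (R := R) (@measurable_id _ (X * Y)%type setT).
apply: (young_mixture (k := k) measurable_snd mf f0 dens _ _ _ _ C0) => //.
- exact: cell_cond_setT.
- by apply: cell_cond_setT; exact: product_marginal1.
- exact: law.
- exact: law.
Qed.

Lemma edge_young_gluing f i j (gamma : {measure set (X * X) -> \bar R})
    (pij : {measure set (X * Y) -> \bar R}) :
  measurable_fun setT f -> (forall z, (0 <= f z)%R) ->
  (forall H : X * Y -> \bar R, (forall z, 0 <= H z) -> measurable_fun setT H ->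
    \int[pi]_z H z =
    \int[product_probability mu nu]_z (H z * (f z)%:E)) ->
  coupling (scaled (mass P i)^-1 (mu_ P i)) (scaled (mass P j)^-1 (mu_ P j))
    gamma ->
  gluing_edge_candidate P pi i j gamma pij ->
  edge_young f i j pij.
Proof.
move=> mf f0 pif cgamma [eij [kgamma [kpi [gammaE piE pijE]]]] C h C0 mh hC.
apply: (young_mixture (@measurable_replace_fst _ _ _ X Y) mf f0
  (cell_cond_density P i mf f0 pif) _ _
  (gluing_law pi_mu eij piE pijE) _ C0) => //.
- exact: cell_cond_setT.
- by apply: cell_cond_setT; exact: product_marginal1.
- exact: gluing_law_product cgamma gammaE.
Qed.

Lemma flow_update_sum (N : {set I * I}) c cand
    (pihat : {measure set (X * Y) -> \bar R}) :
  neighborhood_set N -> flow_update P N pi c cand pihat ->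
  exists2 w, min_cost_flow P N (edge_cost c cand) w &
    forall U, measurable U ->
      pihat U = \sum_(p in N) (w p.1 p.2)%:E * cand p.1 p.2 U.
Proof.
move=> [_ symN] [_ _ [w minw pihatE]]; exists w => // U mU.
rewrite pihatE// (exchange_big_dep predT)//= pair_big_dep/=.
by apply: eq_bigl => -[i j]; rewrite /= symN.
Qed.

Lemma flow_update_coupling (N : {set I * I}) c cand
    (pihat : {measure set (X * Y) -> \bar R}) :
  coupling mu nu pi -> neighborhood_set N ->
  flow_update P N pi c cand pihat -> coupling mu nu pihat.
Proof.
move=> [_ pi_nu] nN update.
have [w [flow_w _] pihatE] := flow_update_sum nN update.
have [cand_edge _ _] := update.
split=> [A mA|B mB].
- have mA' : measurable (fst @^-1` A : set (X * Y)).
    by rewrite -[X in measurable X]setTI; exact: measurable_fst.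
  rewrite /marginal1 /pushforward pihatE// -pi_mu// /marginal1 /pushforward.
  rewrite (cell_cond_sum P pi_mu)//.
  rewrite -(flow_sum_snd flow_w nN)//; apply: eq_bigr => -[i j] /= ijN.
  congr (_ * _); have [cij _] := cand_edge _ _ ijN.
  transitivity (marginal1 (cand i j) A) => //; rewrite cij// /scaled.
  by rewrite -(cell_marginal1 P j pi_mu).
- have mB' : measurable (snd @^-1` B : set (X * Y)).
    by rewrite -[X in measurable X]setTI; exact: measurable_snd.
  rewrite /marginal2 /pushforward pihatE// -pi_nu// /marginal2 /pushforward.
  rewrite (cell_cond_sum P pi_mu)//.
  rewrite -(flow_sum_fst flow_w)//; apply: eq_bigr => -[i j] /= ijN.
  congr (_ * _); have [_ cij] := cand_edge _ _ ijN.
  by transitivity (marginal2 (cand i j) B) => //; rewrite cij.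
Qed.

End edges.

Section objective_decrease.
Local Open Scope ereal_scope.
Context (R : realType) (dX dY : measure_display).
Context (X : borelMetricType R dX) (Y : borelMetricType R dY).
Context (mu : probability X R) (nu : probability Y R).
Context (I : finType) (P : basic_partition mu I) (N : {set I * I}).
Context (c : X * Y -> R) (cand : I -> I -> {measure set (X * Y) -> \bar R}).
Variables (pi pihat : {finite_measure set (X * Y)%type -> \bar R}).
Hypotheses (hpi : coupling mu nu pi) (hN : neighborhood_set N).
Hypothesis hpihat : flow_update P N pi c cand pihat.

Lemma flow_update_cost : (forall z, (0 <= c z)%R) -> bounded_fun c ->
  measurable_fun setT c -> \int[pihat]_z (c z)%:E <= \int[pi]_z (c z)%:E.
Proof.
move=> c0 [M [_ cM]] mc; have [pi_mu _] := hpi; have [Nii _] := hN.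
have [cand_edge cand_diag _] := hpihat.
have [w minw pihatE] := flow_update_sum hN hpihat; have [flow_w _] := minw.
have [w0 _] := flow_w.
have mcE : measurable_fun setT (EFin \o c) by exact/measurable_EFinP.
have cE0 z : 0 <= (c z)%:E by rewrite lee_fin.
pose r i j := Rintegral (cand i j) setT c.
have rE i j : (i, j) \in N -> (r i j)%:E = \int[cand i j]_z (c z)%:E.
  move=> ijN; rewrite /r /Rintegral fineK// ge0_fin_numE ?integral_ge0//.
  apply: (@le_lt_trans _ _ (\int[cand i j]_z (M + 1)%:E)).
    apply: ge0_le_integral => //.
    by move=> z _; rewrite lee_fin (le_trans (ler_norm _))// cM// ltrDl.
  rewrite integral_cst//.
  have [ci1 _] := cand_edge _ _ ijN.
  rewrite [X in _ * X](_ : _ = 1) ?mule1 ?ltry//.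
  transitivity (marginal1 (cand i j) setT) => //; rewrite ci1//.
  transitivity ((mass P j)^-1%:E * mu (setT `&` P j)) => //.
  by rewrite setTI massE -EFinM mulVf// gt_eqF ?mass_gt0.
have diagE i : \int[cell_cond P pi i]_z (c z)%:E = (r i i)%:E.
  rewrite rE//; apply: eq_measure_integral => U mU _.
  by rewrite [RHS]cand_diag.
rewrite (ge0_integral_weighted_sum _ pihatE)//; last first.
  by move=> -[i j]; exact: w0.
rewrite (ge0_integral_cell_sum P pi_mu)//.
under [leRHS]eq_bigr do rewrite diagE.
rewrite -(flow_sum_fst flow_w (F := fun i => (r i i)%:E)); last first.
  by move=> i; rewrite rE//; apply: integral_ge0.
rewrite (eq_bigr (fun p => (w p.1 p.2 * r p.1 p.2)%:E)); last first.
  by move=> [i j] ijN; rewrite /= -rE.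
rewrite [leRHS](eq_bigr (fun p => (w p.1 p.2 * r p.1 p.1)%:E))//.
rewrite !sumEFin lee_fin.
exact: min_cost_flow_le minw.
Qed.

Lemma flow_update_KL
    (gamma : I -> I -> {measure set (X * X) -> \bar R}) :
  (forall i j, (i, j) \in N -> i != j ->
    coupling (scaled (mass P i)^-1 (mu_ P i)) (scaled (mass P j)^-1 (mu_ P j))
      (gamma i j)) ->
  (forall i j, (i, j) \in N -> i != j ->
    gluing_edge_candidate P pi i j (gamma i j) (cand i j)) ->
  KL (charge_of_finite_measure pihat) (product_probability mu nu) <=
  KL (charge_of_finite_measure pi) (product_probability mu nu).
Proof.
move=> hgamma hcand; set sigma := product_probability mu nu.
have [pi_mu _] := hpi.
have [->|KLoo] := eqVneq (KL (charge_of_finite_measure pi) sigma) +oo.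
  exact: leey.
have pis : pi `<< sigma.
  by move: KLoo; rewrite /KL; case: asboolP => [[]//|_]; rewrite eqxx.
have [f [mf f0 pif KLE]] := KL_density pis.
have mKLf : measurable_fun setT (fun z => (KL_integrand (f z))%:E).
  apply/measurable_EFinP; apply: measurableT_comp => //.
  exact: measurable_KL_integrand.
have KLf0 z : 0 <= (KL_integrand (f z))%:E by rewrite lee_fin KL_integrand_ge0.
have KLfin : KL (charge_of_finite_measure pi) sigma \is a fin_num.
  by rewrite ge0_fin_numE ?ltey// KLE integral_ge0.
have [cand_edge cand_diag _] := hpihat.
have [w minw pihatE] := flow_update_sum hN hpihat; have [flow_w _] := minw.
have [w0 _] := flow_w.
have sigma_mu := @product_marginal1 _ _ _ X Y mu nu.
rewrite -[leRHS]fineK//; apply: KL_le_dual.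
  transitivity (marginal1 pihat setT) => //.
  have [pihat_mu _] := flow_update_coupling pi_mu hpi hN hpihat.
  by rewrite pihat_mu//; exact: probability_setT.
move=> C h C0 mh hC; rewrite fineK// KLE.
have hC0 z : 0 <= (h z + C)%:E by rewrite lee_fin -lerBlDr sub0r.
have mhC : measurable_fun setT (fun z => (h z + C)%:E).
  by apply/measurable_EFinP; exact: measurable_funD.
have meh : measurable_fun setT (fun z => (expR (h z))%:E).
  by apply/measurable_EFinP; exact: measurableT_comp.
have eh0 z : 0 <= (expR (h z))%:E by rewrite lee_fin expR_ge0.
have cst_sum (x : R) : (0 <= x)%R ->
    x%:E = \sum_(p in N) (w p.1 p.2)%:E * x%:E.
  move=> x0; rewrite (flow_sum_fst flow_w (F := fun=> x%:E))//.
  rewrite -ge0_sume_distrl; last by move=> i _; rewrite lee_fin ltW ?mass_gt0.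
  rewrite (_ : \sum_i _ = 1) ?mul1e//.
  rewrite -[RHS](probability_setT sigma) (cell_cond_sum P sigma_mu)//.
  by apply: eq_bigr => i _; rewrite cell_cond_setT ?mule1.
rewrite (ge0_integral_weighted_sum _ pihatE)//; last first.
  by move=> -[i j]; exact: w0.
rewrite (cst_sum 1%R)// [X in _ <= _ + X](cst_sum C)//.
rewrite (ge0_integral_cell_sum P sigma_mu KLf0)//.
rewrite (ge0_integral_cell_sum P sigma_mu eh0)//.
have int0 (m : {measure set (X * Y) -> \bar R}) (g : X * Y -> \bar R) :
    (forall z, 0 <= g z) -> 0 <= \int[m]_z g z.
  by move=> g0; exact: integral_ge0.
rewrite -(flow_sum_fst flow_w
  (F := fun i => \int[cell_cond P sigma i]_z (KL_integrand (f z))%:E));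
  last by move=> i; exact: int0.
rewrite -(flow_sum_snd flow_w
  (F := fun i => \int[cell_cond P sigma i]_z (expR (h z))%:E) hN);
  last by move=> i; exact: int0.
rewrite -!big_split/=; apply: lee_sum => -[i j] ijN /=.
have wij : (0 <= w i j)%R by exact: w0.
have i1 := int0 (cand i j) _ hC0.
have i2 := int0 (cell_cond P sigma i) _ KLf0.
have i3 := int0 (cell_cond P sigma j) _ eh0.
have i12 := adde_ge0 i2 i3.
rewrite -ge0_muleDr// -ge0_muleDr// -ge0_muleDr//.
apply: lee_wpmul2l; first by rewrite lee_fin.
have [ij|ij] := eqVneq i j; last first.
  have cij := hgamma _ _ ijN ij.
  exact: (edge_young_gluing pi_mu mf f0 pif cij (hcand _ _ ijN ij)).
move: ijN; rewrite -ij => iiN.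
by apply: (edge_young_diag pi_mu mf f0 pif) => // U mU; rewrite cand_diag.
Qed.

End objective_decrease.

Theorem proposition3p12 (R : realType) (dX dY : measure_display)
    (X : borelMetricType R dX) (Y : borelMetricType R dY)
    (cptX : compact [set: X]) (cptY : compact [set: Y])
    (mu : probability X R) (nu : probability Y R)
    (eps : R) (eps_ge0 : 0 <= eps)
    (c : X * Y -> R) (c_ge0 : forall z, 0 <= c z) (c_bounded : bounded_fun c)
    (c_lsc : lower_semicontinuous (EFin \o c))
    (pi : {finite_measure set (X * Y)%type -> \bar R}) (hpi : coupling mu nu pi)
    (I : finType) (P : basic_partition mu I)
    (N : {set I * I}) (hN : neighborhood_set N)
    (gamma : I -> I -> {measure set (X * X) -> \bar R})
    (hgamma : forall i j, (i, j) \in N -> i != j ->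
       coupling (scaled (mass P i)^-1 (mu_ P i)) (scaled (mass P j)^-1 (mu_ P j))
         (gamma i j))
    (cand : I -> I -> {measure set (X * Y) -> \bar R})
    (hcand : forall i j, (i, j) \in N -> i != j ->
       gluing_edge_candidate P pi i j (gamma i j) (cand i j))
    (pihat : {finite_measure set (X * Y)%type -> \bar R})
    (hpihat : flow_update P N pi c cand pihat) :
  coupling mu nu pihat /\
  (EOT_objective mu nu eps c pihat <= EOT_objective mu nu eps c pi)%E.
Proof.
have [pi_mu _] := hpi; split.
  exact: (flow_update_coupling pi_mu hpi hN hpihat).
have mc : measurable_fun setT c.
  apply/measurable_EFinP.
  exact: (lower_semicontinuous_measurable_prod cptX cptY).
apply: leeD; first exact: (flow_update_cost hpi hN hpihat).
apply: lee_wpmul2l; first by rewrite lee_fin.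
exact: (flow_update_KL hpi hN hpihat hgamma hcand).
Qed.
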